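(* Let $\Sigma$ be an $X$-symmetric graph with valency $\mathrm v\ge2$ and let $\tau\in V(\Sigma)$. If there exists an $X_\tau$-flag-transitive $1$-$(\mathrm v,\kappa,\rho)$ design $\mathfrak D(\tau)$ on the point set $\Sigma(\tau)$ with $1\le\kappa\le\mathrm v-1$ such that $\rho/m(\mathfrak D(\tau))$ is odd, then there exists a self-paired $X$-symmetric orbit $\Theta$ on $DSt^\kappa(\Sigma)$.
   Context: Graphs are finite, simple, undirected; $\Sigma$ is $X$-symmetric if $X$ acts on $V(\Sigma)$ preserving adjacency and transitively on vertices and arcs; $X_\tau$ is the vertex stabiliser and $X_S$ the setwise stabiliser. A $1$-$(\mathrm v,\kappa,\rho)$ design on $\Sigma(\tau)$ is an incidence structure with point set $\Sigma(\tau)$ (of size $\mathrm v$) and a set of blocks, each block incident with exactly $\kappa$ points and each point with exactly $\rho$ blocks; it is $X_\tau$-flag-transitive if $X_\tau$ acts on it (naturally on points, and on blocks) preserving incidence and transitively on incident point-block pairs (flags). The trace of a block is the set of points incident with it; $m(\mathfrak D(\tau))$, the multiplicity, is the (constant) number of blocks with a given trace. For $S\subseteq\Sigma(\tau)$ with $|S|=\kappa$, the $\kappa$-star is $\mathfrak s(\tau,S)=\{(\tau,\sigma):\sigma\in S\}$; it is symmetric if $X_\tau\cap X_S$ is transitive on $S$; a set of stars is $X$-symmetric if it is a single $X$-orbit containing a symmetric star. A $\kappa$-double star is a pair $(\mathfrak l,\mathfrak r)$ of $\kappa$-stars $\mathfrak l=\mathfrak s(\tau,L)$, $\mathfrak r=\mathfrak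 s(\sigma,R)$ with $\sigma\in L$ and $\tau\in R$; $DSt^\kappa(\Sigma)$ is the set of them. An $X$-orbit $\Theta$ on $DSt^\kappa(\Sigma)$ is $X$-symmetric if $\{\mathfrak l,\mathfrak r:(\mathfrak l,\mathfrak r)\in\Theta\}$ is $X$-symmetric, and self-paired if $(\mathfrak l,\mathfrak r)\in\Theta$ implies $(\mathfrak r,\mathfrak l)\in\Theta$. *)

(* Defs.v *)
From HB Require Import structures.
From mathcomp Require Import all_boot.

Set Implicit Arguments.
Unset Strict Implicit.
Unset Printing Implicit Defensive.

Section Actions.

Variable X : groupType.

(* Right action of the subgroup D of X on T; the values [to t x] with x outside
   D are irrelevant.                                                          *)
Definition acts_by (D : X -> Prop) (T : Type) (to : T -> X -> T) : Prop :=
  (forall t, to t 1%g = t) /\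
  (forall t x y, D x -> D y -> to t (x * y)%g = to (to t x) y).

Definition is_action (T : Type) (to : T -> X -> T) : Prop :=
  acts_by (fun=> True) to.

Definition set_act (T : finType) (to : T -> X -> T) (S : {set T}) (x : X) :
  {set T} := [set to t x | t in S].

Definition pair_act (T U : Type) (toT : T -> X -> T) (toU : U -> X -> U)
  (p : T * U) (x : X) : T * U := (toT p.1 x, toU p.2 x).

Definition stab (T : Type) (to : T -> X -> T) (t : T) (x : X) : Prop :=
  to t x = t.

Definition is_orbit (T : finType) (to : T -> X -> T) (O : {set T}) : Prop :=
  exists t, forall t', t' \in O <-> exists x, t' = to t x.

End Actions.

Section SymmetricGraphs.

Variables (X : groupType) (V : finType) (E : rel V) (to : V -> X -> V).

Definition simple_graph : Prop := symmetric E /\ irreflexive E.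

Definition nbhd (t : V) : {set V} := [set s | E t s].

Definition valency (v : nat) : Prop := forall t, #|nbhd t| = v.

Definition symmetric_graph : Prop :=
  [/\ is_action to,
      forall x s t, E (to s x) (to t x) = E s t,
      forall s t, exists x, to s x = t
    & forall s t s' t', E s t -> E s' t' ->
        exists x, to s x = s' /\ to t x = t'].

Definition star (t : V) (S : {set V}) : {set V * V} := [set (t, s) | s in S].

Definition star_act : {set V * V} -> X -> {set V * V} :=
  set_act (pair_act to to).

Definition is_star (kappa : nat) (t : V) (S : {set V}) : Prop :=
  S \subset nbhd t /\ #|S| = kappa.

Definition symmetric_star (t : V) (S : {set V}) : Prop :=
  forall s s', s \in S -> s' \in S ->
    exists x, [/\ stab to t x, stab (set_act to) S x & to s x = s'].

Definition symmetric_star_set (kappa : nat) (A : {set {set V * V}}) : Prop :=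
  is_orbit star_act A /\
  exists t S, [/\ is_star kappa t S, star t S \in A & symmetric_star t S].

Definition is_double_star (kappa : nat) (d : {set V * V} * {set V * V}) : Prop :=
  exists t s L R,
    [/\ is_star kappa t L, is_star kappa s R, s \in L, t \in R
      & d = (star t L, star s R)].

Definition dstar_orbit (kappa : nat) (Th : {set {set V * V} * {set V * V}}) :
  Prop :=
  (forall d, d \in Th -> is_double_star kappa d) /\
  is_orbit (pair_act star_act star_act) Th.

Definition symmetric_dstars (kappa : nat)
  (Th : {set {set V * V} * {set V * V}}) : Prop :=
  symmetric_star_set kappa ([set d.1 | d in Th] :|: [set d.2 | d in Th]).

Definition self_paired (Th : {set {set V * V} * {set V * V}}) : Prop :=
  forall l r, (l, r) \in Th -> (r, l) \in Th.

End SymmetricGraphs.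

Section Designs.

Variables (X : groupType) (V B : finType) (to : V -> X -> V).
Variable inc : V -> B -> bool.

Definition trace (b : B) : {set V} := [set p | inc p b].

(* The incidence relation is given on all of V, so the second clause confines
   it to the point set P.                                                     *)
Definition is_design (P : {set V}) (v kappa rho : nat) : Prop :=
  [/\ #|P| = v,
      forall b, trace b \subset P,
      forall b, #|trace b| = kappa
    & forall p, p \in P -> #|[set b | inc p b]| = rho].

Definition is_multiplicity (m : nat) : Prop :=
  forall b, #|[set b' | trace b' == trace b]| = m.

Definition flag_transitive (D : X -> Prop) (P : {set V}) (toB : B -> X -> B) :
  Prop :=
  [/\ acts_by D toB,
      forall x p b, D x -> p \in P -> inc (to p x) (toB b x) = inc p b
    & forall p b p' b', inc p b -> inc p' b' ->
        exists x, [/\ D x, to p x = p' & toB b x = b']].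

End Designs.

(* The multiplicity of a flag-transitive design exists, and it divides rho, so
   that rho / m is a natural number.                                          *)

Lemma flag_transitive_multiplicity (X : groupType) (V B : finType) (E : rel V)
    (to : V -> X -> V) (inc : V -> B -> bool) (toB : B -> X -> B) (t : V)
    (v kappa rho : nat) :
  symmetric_graph E to -> is_design inc (nbhd E t) v kappa rho -> 0 < kappa ->
  flag_transitive to inc (stab to t) (nbhd E t) toB ->
  exists m, is_multiplicity inc m.
Proof.
move=> [[to1 toM] toE _ _] [_ trP trK _] k_gt0 [[tB1 tBM] incP ftr].
have stV x : stab to t x -> stab to t x^-1%g.
  by move=> sx; rewrite /stab -{1}sx -toM // mulgV to1.
have toK x u : to (to u x^-1%g) x = u by rewrite -toM // mulVg to1.
have tBK x : stab to t x -> cancel (toB^~ x) (toB^~ x^-1%g).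
  by move=> sx b; rewrite -tBM ?mulgV ?tB1 //; apply: stV.
have nbE x p : stab to t x -> (to p x \in nbhd E t) = (p \in nbhd E t).
  by move=> sx; rewrite !inE -{1}sx toE.
have trE x b p : stab to t x ->
    (to p x \in trace inc (toB b x)) = (p \in trace inc b).
  move=> sx; have [pP|pNP] := boolP (p \in nbhd E t); first by rewrite !inE incP.
  transitivity false.
    by apply/negP => /(subsetP (trP _)); rewrite nbE // (negPf pNP).
  by apply/esym/negP => /(subsetP (trP _)); rewrite (negPf pNP).
have le b0 b1 : #|[set b' | trace inc b' == trace inc b0]|
             <= #|[set b' | trace inc b' == trace inc b1]|.
  have /card_gt0P[p0] : 0 < #|trace inc b0| by rewrite trK.
  have /card_gt0P[p1] : 0 < #|trace inc b1| by rewrite trK.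
  rewrite !inE => i1 i0; have [x [sx _ xb]] := ftr _ _ _ _ i0 i1.
  rewrite -(card_imset _ (can_inj (tBK x sx))) subset_leq_card //.
  apply/subsetP => _ /imsetP[b + ->]; rewrite !inE => /eqP e.
  by apply/eqP/setP => u; rewrite -(toK x u) -xb !trE // e.
have [b0 _|B0] := pickP (@predT B); last by exists 0 => b; have := B0 b.
exists #|[set b' | trace inc b' == trace inc b0]| => b.
by apply/eqP; rewrite eqn_leq !le.
Qed.

Lemma multiplicity_dvd (V B : finType) (inc : V -> B -> bool) (P : {set V})
    (v kappa rho m : nat) :
  is_design inc P v kappa rho -> 0 < v -> is_multiplicity inc m -> m %| rho.
Proof.
move=> [cP _ _ rP] v_gt0 mP.
have /card_gt0P[p pP] : 0 < #|P| by rewrite cP.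
rewrite -(rP p pP) -sum1_card (partition_big_imset (trace inc)) /=.
apply: dvdn_sum => _ /imsetP[b + ->]; rewrite inE => ipb.
rewrite sum1dep_card -(mP b).
rewrite (_ : [set _ | _] = [set b' | trace inc b' == trace inc b]) //.
apply/setP => b'; rewrite !inE; case: eqP => [e|]; rewrite ?andbF // andbT.
have : p \in trace inc b' by rewrite e inE.
by rewrite inE => ->.
Qed.

(* Main.v *)
(** Fix an arc (tau, sigma), an element x of X that swaps tau and sigma, and
    let A be the set of the traces through sigma; #|A| = rho / m is odd.  The
    square of x fixes both tau and sigma, hence permutes A, and a permutation of
    a set of odd size has a cycle of odd length n.  For L in such a cycle, the
    odd power y := x ^+ n swaps tau and sigma and y ^+ 2 fixes L; therefore y
    swaps the two stars s(tau, L) and s(sigma, L ^ y), and the orbit of this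
    double star is self-paired.  It is symmetric because the design is
    flag-transitive. *)

Require Import Defs.
From mathcomp Require Import all_boot.
From mathcomp Require Import boolp.

Set Implicit Arguments.
Unset Strict Implicit.

(** Strong induction on [#|A|]: if the cycle of some [a] in [A] has even length, removing it leaves
    a stable set that is smaller and still of odd size. *)
Lemma odd_cycle (T : finType) (f : T -> T) (A : {set T}) :
  injective f -> {homo f : x / x \in A} -> odd #|A| ->
  exists2 a, a \in A & exists2 n, odd n & iter n f a = a.
Proof.
move=> injf; have [n] := ubnP #|A|; elim: n A => // n IHn A.
rewrite ltnS => leAn fA oddA.
have /card_gt0P[a aA] : 0 < #|A| by case: #|A| oddA.
have iterA k : iter k f a \in A by elim: k => //= k /fA.
pose O := [set b in orbit f a].
have cardO : #|O| = order f a.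
  by rewrite cardsE (card_uniqP (orbit_uniq f a)) size_orbit.
have [odd_a|even_a] := boolP (odd (order f a)).
  by exists a => //; exists (order f a); last exact: iter_order.
have subOA : O \subset A.
  apply/subsetP => b; rewrite inE -fconnect_orbit => /iter_findex <-.
  exact: iterA.
have cardD : (#|A :\: O| + order f a)%N = #|A|.
  by rewrite -cardO cardsD (setIidPr subOA) subnK ?subset_leq_card.
have [|||b /setDP[bA _] [k oddk kb]] := IHn (A :\: O).
- by apply: leq_trans leAn; rewrite -cardD -addn1 leq_add2l order_gt0.
(* By injectivity, [f b] lies on the cycle of [a] only if [b] does. *)
- move=> b /setDP[bA bNO]; rewrite inE fA // andbT.
  apply: contraNN bNO; rewrite !inE -!fconnect_orbit => afb.
  by rewrite (same_fconnect1_r injf).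
- by move: oddA; rewrite -cardD oddD (negPf even_a) addbF.
- by exists b => //; exists k.
Qed.

(** Group the blocks through [p] by trace: all [m] blocks sharing such a trace contain [p], so every
    class has size [m]. *)
Lemma card_traces (V B : finType) (inc : V -> B -> bool) (p : V) (m : nat) :
  is_multiplicity inc m ->
  #|[set b | inc p b]| = (#|[set trace inc b | b in [set b | inc p b]]| * m)%N.
Proof.
move=> mP; rewrite -sum1_card (partition_big_imset (trace inc)) /= -sum_nat_const.
apply: eq_bigr => _ /imsetP[b + ->]; rewrite inE => ipb.
rewrite sum1dep_card -(mP b); apply: eq_card => b'; rewrite !inE.
case: eqP => [e|]; rewrite ?andbF // andbT.
have : p \in trace inc b' by rewrite e inE.
by rewrite inE.
Qed.

Section Actions.

Variable X : groupType.

Lemma acts_set_act (T : finType) (to : T -> X -> T) :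
  is_action to -> is_action (set_act to).
Proof.
move=> [to1 toM]; split=> [S|S x y _ _].
  by rewrite /set_act (eq_imset _ to1) imset_id.
by rewrite /set_act -imset_comp; apply: eq_imset => t; exact: toM.
Qed.

Lemma acts_pair_act (T U : Type) (toT : T -> X -> T) (toU : U -> X -> U) :
  is_action toT -> is_action toU -> is_action (pair_act toT toU).
Proof.
move=> [toT1 toTM] [toU1 toUM]; split=> [[t u]|[t u] x y _ _].
  by rewrite /pair_act toT1 toU1.
by rewrite /pair_act toTM // toUM.
Qed.

Lemma act_inj (T : Type) (to : T -> X -> T) (x : X) :
  is_action to -> injective (to^~ x).
Proof.
move=> [to1 toM]; apply: (can_inj (g := to^~ x^-1%g)) => t.
by rewrite -toM // mulgV to1.
Qed.

Lemma act_iter (T : Type) (to : T -> X -> T) (x : X) (n : nat) (t : T) :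
  is_action to -> to t (x ^+ n)%g = iter n (to^~ x) t.
Proof.
move=> [to1 toM]; elim: n => [|n IHn]; first by rewrite expg0 to1.
by rewrite expgSr toM // IHn.
Qed.

(** [X] may be infinite, so membership is decided classically. *)
Definition orbit_set (T : finType) (to : T -> X -> T) (t : T) : {set T} :=
  [set t' | `[< exists x, t' = to t x >]].

Lemma orbit_setP (T : finType) (to : T -> X -> T) (t t' : T) :
  reflect (exists x, t' = to t x) (t' \in orbit_set to t).
Proof. by rewrite inE; apply: asboolP. Qed.

End Actions.

Section Stars.

Variables (X : groupType) (V : finType) (E : rel V) (to : V -> X -> V).
Hypothesis symE : symmetric_graph E to.

Lemma star_act_star (t : V) (S : {set V}) (x : X) :
  star_act to (star t S) x = star (to t x) (set_act to S x).
Proof. by rewrite /star_act /set_act /star -!imset_comp. Qed.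

Lemma is_star_act (kappa : nat) (t : V) (S : {set V}) (x : X) :
  is_star E kappa t S -> is_star E kappa (to t x) (set_act to S x).
Proof.
have [toP toE _ _] := symE.
move=> [/subsetP subS cardS]; split; last first.
  by rewrite card_imset //; apply: act_inj.
apply/subsetP => _ /imsetP[s sS ->]; rewrite inE toE.
by move/subS: sS; rewrite inE.
Qed.

(* The double star is (s(t, L), s(s, L ^ y)). *)
Lemma self_paired_orbit (kappa : nat) (t s : V) (L : {set V}) (y : X) :
    is_star E kappa t L -> symmetric_star to t L -> s \in L ->
    to t y = s -> to s y = t -> set_act to (set_act to L y) y = L ->
  exists Th : {set {set V * V} * {set V * V}},
    [/\ dstar_orbit E to kappa Th, symmetric_dstars E to kappa Th
      & self_paired Th].
Proof.
move=> starL symL sL ty sy Lyy; have [toP toE _ _] := symE.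
have saP : is_action (star_act to) by apply/acts_set_act/acts_pair_act.
pose l := star t L; pose r := star s (set_act to L y).
have ly : star_act to l y = r by rewrite star_act_star ty.
have ry : star_act to r y = l by rewrite star_act_star sy Lyy.
pose Th := orbit_set (pair_act (star_act to) (star_act to)) (l, r).
exists Th; split.
- split=> [_ /orbit_setP[x ->]|]; last first.
    by exists (l, r) => d; split=> /orbit_setP.
  exists (to t x), (to s x), (set_act to L x),
    (set_act to (set_act to L y) x); split.
  + exact: is_star_act.
  + by apply: is_star_act; rewrite -ty; apply: is_star_act.
  + exact: imset_f.
  + by apply/imset_f/imsetP; exists s.
  + by rewrite /pair_act /= !star_act_star.
(* As [r] is the image of [l] under [y], left and right stars form one and the same orbit, that of
   [l]. *)
- have orbE z : z \in [set d.1 | d in Th] :|: [set d.2 | d in Th] <->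
      exists x, z = star_act to l x.
    split=> [/setUP[]/imsetP[_ /orbit_setP[x ->] ->]|[x ->]] /=.
    + by exists x.
    + by exists (y * x)%g; rewrite saP.2 // ly.
    + apply/setUP; left; apply/imsetP.
      by exists (pair_act (star_act to) (star_act to) (l, r) x) => //;
        apply/orbit_setP; exists x.
  split; first by exists l.
  by exists t, L; split=> //; apply/orbE; exists 1%g; rewrite saP.1.
(* Since [y] swaps [l] and [r], applying [y] before [x] reverses the pair. *)
- move=> l' r' /orbit_setP[x [-> ->]]; apply/orbit_setP; exists (y * x)%g.
  by rewrite /pair_act /= !saP.2 // ly ry.
Qed.

End Stars.

Section FlagTransitiveDesigns.

Variables (X : groupType) (V B : finType) (E : rel V) (to : V -> X -> V).
Variables (inc : V -> B -> bool) (toB : B -> X -> B) (t : V).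
Variables (v kappa rho : nat).
Hypothesis symE : symmetric_graph E to.
Hypothesis designD : is_design inc (nbhd E t) v kappa rho.
Hypothesis flagD : flag_transitive to inc (stab to t) (nbhd E t) toB.

(** Invariance of incidence gives one inclusion; both sides have [kappa] points. *)
Lemma trace_act (b : B) (x : X) :
  stab to t x -> set_act to (trace inc b) x = trace inc (toB b x).
Proof.
have [toP _ _ _] := symE; have [_ trP trK _] := designD.
have [_ incE _] := flagD.
move=> tx; apply/eqP; rewrite eqEcard card_imset ?trK ?leqnn ?andbT; last first.
  exact: act_inj.
apply/subsetP => _ /imsetP[p pb ->].
by rewrite inE incE ?(subsetP (trP b)) // -[inc _ _](in_set (inc^~ b)).
Qed.

(** An element taking the flag [(s, b)] to [(s', b)] fixes [b], hence its trace. *)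
Lemma symmetric_star_trace (b : B) : symmetric_star to t (trace inc b).
Proof.
have [_ _ flagtr] := flagD.
move=> s s'; rewrite !inE => sb s'b; have [x [tx sx bx]] := flagtr _ _ _ _ sb s'b.
by exists x; split=> //; rewrite /stab trace_act // bx.
Qed.

End FlagTransitiveDesigns.

Unset Implicit Arguments.

Theorem theorem3p6 (X : groupType) (V : finType) (E : rel V) (to : V -> X -> V)
    (v : nat) (tau : V)
    (graphE : simple_graph E) (symE : symmetric_graph E to)
    (valE : valency E v) (v_ge2 : 2 <= v)
    (B : finType) (inc : V -> B -> bool) (toB : B -> X -> B)
    (kappa rho m : nat)
    (designD : is_design inc (nbhd E tau) v kappa rho)
    (flagD : flag_transitive to inc (stab to tau) (nbhd E tau) toB)
    (kappa_bounds : 1 <= kappa <= v - 1)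
    (multD : is_multiplicity inc m)
    (odd_rho : odd (rho %/ m)) :
  exists Th : {set {set V * V} * {set V * V}},
    [/\ dstar_orbit E to kappa Th, symmetric_dstars E to kappa Th
      & self_paired Th].
Proof.
have [toP _ _ arctr] := symE; have [_ trP trK rhoP] := designD.
have /card_gt0P[sigma sN] : 0 < #|nbhd E tau| by rewrite valE ltnW.
have tau_sigma : E tau sigma by rewrite inE in sN.
have [x [tx sx]] : exists x, to tau x = sigma /\ to sigma x = tau.
  by apply: arctr; rewrite // graphE.1.
pose A := [set trace inc b | b in [set b | inc sigma b]].
have oddA : odd #|A|.
  move: odd_rho; rewrite -(rhoP _ sN) (card_traces sigma multD).
  (* For [m = 0] the quotient is 0 by convention, which is not odd. *)
  by case: (posnP m) => [->|m_gt0]; rewrite ?divn0 ?mulnK.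
have txx : to tau (x ^+ 2)%g = tau by rewrite act_iter //= tx.
have sxx : to sigma (x ^+ 2)%g = sigma by rewrite act_iter //= sx.
have set_toP := acts_set_act toP.
(* Traces go to traces because [x ^+ 2] fixes [tau], and they still contain [sigma] because it fixes
   [sigma]. *)
have AP L : L \in A -> set_act to L (x ^+ 2)%g \in A.
  case/imsetP=> b; rewrite inE => sb ->.
  rewrite (trace_act symE designD flagD) //.
  apply: imset_f; rewrite inE -sxx; have [_ incE _] := flagD.
  by rewrite incE.
have [L /imsetP[b + ->]] := odd_cycle (act_inj (x := (x ^+ 2)%g) set_toP) AP oddA.
rewrite inE => sb [n odd_n nb].
(* With [n = 2k + 1], the factor [x ^+ (2k)] fixes [u]. *)
have yE u : to (to u x) x = u -> to u (x ^+ n)%g = to u x.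
  move=> uxx; rewrite -[n]odd_double_half odd_n add1n expgSr toP.2 //.
  congr to; rewrite -mul2n expgnA act_iter //; elim: n./2 => //= k ->.
  by rewrite expg2 toP.2.
apply: (self_paired_orbit symE (t := tau) (s := sigma) (L := trace inc b)
  (y := (x ^+ n)%g)).
- by split.
- exact: (symmetric_star_trace symE designD flagD).
- by rewrite inE.
- by rewrite yE tx ?sx.
- by rewrite yE sx ?tx.
(* The square of [x ^+ n] is the [n]-th power of [x ^+ 2], which fixes the trace by [nb]. *)
- by rewrite -set_toP.2 // -expgnDr addnn -mul2n expgnA act_iter.
Qed.
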